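(* In every Dynamic Generative System with Symmetry (DGSS), for all objects $x, y, z$: $(z\,x) = (z\,y)$ if and only if $x = y$.
   Context: Relational Calculus: there is a collection of objects with a binary application operation; the application of $a$ to $b$ is written $(a\,b)$ and is again an object. Application is associative: for all objects $a,b,c$, $(a\,b\,c) = ((a\,b)\,c) = (a\,(b\,c))$. The symbol $=$ is the logical equality sign, with the classical deduction rules (reflexivity, symmetry, transitivity). A Dynamic Generative System with Symmetry (DGSS) is such a system with a distinguished object $\overline{x}$ satisfying: (i) for all $y$, $(\overline{x}\,y) = y$; (ii) for all $y$ there exists $z$ with $(z\,y) = \overline{x}$; (iii) for all $y$ there exists $z$ with $(z\,y) = (y\,z) = \overline{x}$. All variables range over all objects. *)

(* Defs.v *)
(* Logical equality between objects is rendered by Leibniz equality [=]. *)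
Record RelationalCalculus : Type := {
  object :> Type;
  app : object -> object -> object;
  app_assoc : forall a b c : object, app (app a b) c = app a (app b c)
}.

Arguments app {r} _ _.

Record DGSS : Type := {
  dgss_rc :> RelationalCalculus;
  xbar : dgss_rc;
  xbar_app : forall y : dgss_rc, app xbar y = y;
  (* Implied by [dgss_symmetry], but kept as one of the three defining axioms. *)
  dgss_generation : forall y : dgss_rc, exists z : dgss_rc, app z y = xbar;
  dgss_symmetry : forall y : dgss_rc,
    exists z : dgss_rc, app z y = app y z /\ app y z = xbar
}.

(* Main.v *)
Require Import Defs.

Theorem proposition3p3 (D : DGSS) (x y z : D) :
  app z x = app z y <-> x = y.
Proof.
  split; intro H.
  - (* Cancel z by applying its inverse w on the left of both sides. *)
    destruct (dgss_symmetry D z) as [w [Hwz Hzw]].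
    rewrite Hzw in Hwz.
    rewrite <- (xbar_app D x), <- (xbar_app D y), <- Hwz, !app_assoc, H.
    reflexivity.
  - rewrite H; reflexivity.
Qed.
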